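(* Let $\{F_n\}_{n\ge 0}$ be a sequence of natural numbers with $F_n\ge 1$ for $n\ge1$ (and $F_0=1$, or exceptionally $F_0=0$), and let $\Pi$ be the cobweb poset designated by it. Let $\eta=\zeta-\delta$ in the incidence algebra $I(\Pi)$. Then for every integer $k\ge1$ and all $x=\langle s,t\rangle$, $y=\langle u,v\rangle$ in $\Pi$, the $k$-th power of $\eta$ in $I(\Pi)$ satisfies $$\eta^k(x,y)=\sum_{x<z_1<z_2<\dots<z_{k-1}<y}1=\sum_{t<i_1<i_2<\dots<i_{k-1}<v}F_{i_1}F_{i_2}\cdots F_{i_{k-1}},$$ where the first sum is over tuples $(z_1,\dots,z_{k-1})$ of elements of $\Pi$ and the second over tuples $(i_1,\dots,i_{k-1})$ of integers satisfying the indicated chains of inequalities (for $k=1$ the first is $1$ if $x<y$ and $0$ otherwise, and the second is $1$ if $t<v$ and $0$ otherwise).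
   Context: Cobweb poset: for $s\ge 1$ the $s$-th level is $\Phi_s=\{\langle j,s\rangle : 1\le j\le F_s\}$, and $\Phi_0=\{\langle 1,0\rangle\}$ is a single root (this is also the convention when $F_0=0$). The cobweb poset is $\Pi=(V,\le)$ with $V=\bigcup_{s\ge 0}\Phi_s$ and $\langle s,t\rangle\le\langle u,v\rangle$ if and only if $t<v$, or $t=v$ and $s=u$. It is locally finite. Incidence algebra: for an associative ring $R$ with identity, $I(\Pi)$ is the set of functions $f:\Pi\times\Pi\to R$ with $f(x,y)=0$ unless $x\le y$, with pointwise addition and scalar multiplication and product $(f*g)(x,y)=\sum_{x\le z\le y}f(x,z)g(z,y)$. Its identity is $\delta(x,y)$, the Kronecker delta. The zeta function is $\zeta(x,y)=1$ if $x\le y$ and $0$ otherwise; thus $\eta(x,y)=1$ if $x<y$ and $0$ otherwise. Powers are with respect to $*$, and integers are regarded as elements of $R$ in the usual way. *)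

(* Defs.v *)
From HB Require Import structures.
From mathcomp Require Import all_boot all_order all_algebra.
From mathcomp Require Import boolp classical_sets functions cardinality fsbigop.

Set Implicit Arguments.
Unset Strict Implicit.
Unset Printing Implicit Defensive.

Import Order.TTheory GRing.Theory.

Local Open Scope ring_scope.
Local Open Scope classical_set_scope.

(* Level 0 is a single root, even when F 0 = 0. *)
Definition level_size (F : nat -> nat) (s : nat) : nat :=
  if s is 0 then 1 else F s.

(* The pair (j, s) stands for the vertex <j, s>. *)
Definition is_vertex (F : nat -> nat) (p : nat * nat) : bool :=
  (1 <= p.1 <= level_size F p.2)%N.

Record cobweb (F : nat -> nat) : Type := Vertex {
  vertex_val : nat * nat;
  vertex_valP : is_vertex F vertex_val
}.

HB.instance Definition _ (F : nat -> nat) :=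
  [isSub for @vertex_val F].
HB.instance Definition _ (F : nat -> nat) := [Countable of cobweb F by <:].

Definition vindex (F : nat -> nat) (x : cobweb F) : nat := (val x).1.
Definition vlevel (F : nat -> nat) (x : cobweb F) : nat := (val x).2.

Definition cobweb_le (F : nat -> nat) (x y : cobweb F) : bool :=
  (vlevel x < vlevel y)%N ||
  (vlevel x == vlevel y) && (vindex x == vindex y).

Section CobwebOrder.
Variable F : nat -> nat.

Lemma cobweb_leE (x y : cobweb F) :
  cobweb_le x y = (vlevel x < vlevel y)%N || (x == y).
Proof.
rewrite /cobweb_le; congr orb; rewrite -(inj_eq val_inj) /vlevel /vindex.
by case: (val x) (val y) => [a b] [c d]; rewrite xpair_eqE andbC.
Qed.

Lemma cobweb_le_refl : reflexive (@cobweb_le F).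
Proof. by move=> x; rewrite cobweb_leE eqxx orbT. Qed.

Lemma cobweb_le_anti : antisymmetric (@cobweb_le F).
Proof.
move=> x y; rewrite !cobweb_leE => /andP[/orP[xy|/eqP//] /orP[yx|/eqP//]].
by have := ltn_trans xy yx; rewrite ltnn.
Qed.

Lemma cobweb_le_trans : transitive (@cobweb_le F).
Proof.
move=> y x z; rewrite !cobweb_leE => /orP[xy|/eqP->//] /orP[yz|/eqP<-].
  by rewrite (ltn_trans xy yz).
by rewrite xy.
Qed.

End CobwebOrder.

Fact cobweb_display : Order.disp_t. Proof. exact: Order.Disp tt tt. Qed.

HB.instance Definition _ (F : nat -> nat) :=
  Order.Le_isPOrder.Build cobweb_display (cobweb F)
    (@cobweb_le_refl F) (@cobweb_le_anti F) (@cobweb_le_trans F).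

Section LocallyFinite.
Variable F : nat -> nat.
Implicit Types x y z : cobweb F.

Lemma cobweb_orderE x y : (x <= y)%O = (vlevel x < vlevel y)%N || (x == y).
Proof. exact: cobweb_leE. Qed.

Lemma cobweb_ltE x y : (x < y)%O = (vlevel x < vlevel y)%N.
Proof.
rewrite lt_neqAle cobweb_orderE; have [->|] := eqVneq x y; first by rewrite ltnn.
by rewrite orbF.
Qed.

Lemma le_vlevel x y : (x <= y)%O -> (vlevel x <= vlevel y)%N.
Proof. by rewrite cobweb_orderE => /orP[/ltnW//|/eqP->]. Qed.

Definition vertices_upto (n : nat) : seq (cobweb F) :=
  undup (pmap insub
    [seq (j, s) | s <- iota 0 n.+1, j <- iota 1 (level_size F s)]).

Lemma vertices_upto_uniq n : uniq (vertices_upto n).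
Proof. exact: undup_uniq. Qed.

Lemma mem_vertices_upto n x : (x \in vertices_upto n) = (vlevel x <= n)%N.
Proof.
rewrite mem_undup mem_pmap_sub; apply/allpairsPdep/idP.
  move=> [s [j [sn _ xE]]]; move: sn; rewrite mem_iota /vlevel.
  by move: xE => /= ->; rewrite add0n ltnS.
move=> xn; exists (vlevel x), (vindex x); split.
- by rewrite mem_iota add0n ltnS.
- by rewrite mem_iota add1n ltnS; exact: (valP x).
- by rewrite /vlevel /vindex; exact: surjective_pairing.
Qed.

Lemma finite_interval x y : finite_set [set z | (x <= z <= y)%O].
Proof.
apply: (@sub_finite_set _ _ [set` vertices_upto (vlevel y)]) => //.
by move=> z /= /andP[_ /le_vlevel]; rewrite mem_vertices_upto.
Qed.

End LocallyFinite.

Record incidence (F : nat -> nat) (R : pzRingType) : Type := Incidence {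
  incidence_fun :> cobweb F -> cobweb F -> R;
  incidenceP : forall x y, ~~ (x <= y)%O -> incidence_fun x y = 0
}.

HB.instance Definition _ (F : nat -> nat) (R : pzRingType) :=
  gen_eqMixin (incidence F R).
HB.instance Definition _ (F : nat -> nat) (R : pzRingType) :=
  gen_choiceMixin (incidence F R).

Section IncidenceOps.
Variables (F : nat -> nat) (R : pzRingType).
Implicit Types (f g h : incidence F R) (x y z : cobweb F).

Lemma incidence_ext f g : (forall x y, f x y = g x y) -> f = g.
Proof.
case: f g => [f fP] [g gP] /= fg.
have {}fg : f = g by apply/funext => x; apply/funext => y; exact: fg.
by subst g; congr Incidence; exact: Prop_irrelevance.
Qed.

Lemma inc_zeroP x y : ~~ (x <= y)%O -> 0 = 0 :> R.
Proof. by []. Qed.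
Definition inc_zero : incidence F R :=
  @Incidence F R (fun _ _ => 0) inc_zeroP.

Lemma inc_addP f g x y : ~~ (x <= y)%O -> f x y + g x y = 0.
Proof. by move=> xy; rewrite !incidenceP// addr0. Qed.
Definition inc_add f g : incidence F R :=
  @Incidence F R (fun x y => f x y + g x y) (@inc_addP f g).

Lemma inc_oppP f x y : ~~ (x <= y)%O -> - f x y = 0.
Proof. by move=> xy; rewrite incidenceP// oppr0. Qed.
Definition inc_opp f : incidence F R :=
  @Incidence F R (fun x y => - f x y) (@inc_oppP f).

Lemma inc_deltaP x y : ~~ (x <= y)%O -> (x == y)%:R = 0 :> R.
Proof. by apply: contraNeq; case: (eqVneq x y) => [->|_]; rewrite ?lexx// eqxx. Qed.
Definition delta : incidence F R :=
  @Incidence F R (fun x y => (x == y)%:R) inc_deltaP.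

Lemma inc_zetaP x y : ~~ (x <= y)%O -> (x <= y)%O%:R = 0 :> R.
Proof. by move=> /negbTE->. Qed.
Definition zeta : incidence F R :=
  @Incidence F R (fun x y => (x <= y)%O%:R) inc_zetaP.

Lemma inc_convP f g x y : ~~ (x <= y)%O ->
  \sum_(z \in [set z | (x <= z <= y)%O]) f x z * g z y = 0.
Proof.
move=> xy; apply: fsbig1 => z /= /andP[xz zy].
by rewrite (le_trans xz zy) in xy.
Qed.
(* The intervals are finite by finite_interval. *)
Definition conv f g : incidence F R :=
  @Incidence F R
    (fun x y => \sum_(z \in [set z | (x <= z <= y)%O]) f x z * g z y)
    (@inc_convP f g).

Lemma conv_upto (n : nat) f g x y : (vlevel y <= n)%N ->
  conv f g x y = \sum_(z <- vertices_upto F n) f x z * g z y.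
Proof.
move=> yn; rewrite fsbig_seq ?vertices_upto_uniq//=.
apply: fsbig_widen => [z /= /andP[_ /le_vlevel zy]|z /= [_ /negP]].
  by rewrite mem_vertices_upto (leq_trans zy).
rewrite negb_and => /orP[xz|zy]; first by rewrite (incidenceP f xz) mul0r.
by rewrite (incidenceP g zy) mulr0.
Qed.

Lemma inc_addA : associative inc_add.
Proof. by move=> f g h; apply: incidence_ext => x y /=; exact: addrA. Qed.

Lemma inc_addC : commutative inc_add.
Proof. by move=> f g; apply: incidence_ext => x y /=; exact: addrC. Qed.

Lemma inc_add0 : left_id inc_zero inc_add.
Proof. by move=> f; apply: incidence_ext => x y /=; exact: add0r. Qed.

Lemma inc_addN : left_inverse inc_zero inc_opp inc_add.
Proof. by move=> f; apply: incidence_ext => x y /=; exact: addNr. Qed.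

HB.instance Definition _ :=
  GRing.isZmodule.Build (incidence F R) inc_addA inc_addC inc_add0 inc_addN.

Lemma inc_addE f g x y : (f + g) x y = f x y + g x y.
Proof. by []. Qed.

Lemma convA : associative conv.
Proof.
move=> f g h; apply: incidence_ext => x y.
rewrite !(conv_upto _ _ _ (leqnn _)); set s := vertices_upto _ _.
transitivity (\sum_(z <- s) \sum_(w <- s) f x z * g z w * h w y).
  apply: eq_bigr => z _; rewrite (conv_upto _ _ _ (leqnn _)) mulr_sumr.
  by apply: eq_bigr => w _; rewrite mulrA.
rewrite exchange_big /= !big_seq; apply: eq_bigr => w ws.
rewrite -mulr_suml -conv_upto//.
by rewrite mem_vertices_upto in ws.
Qed.

Lemma conv1f : left_id delta conv.
Proof.
move=> f; apply: incidence_ext => x y.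
have [xy|xy] := boolP (x <= y)%O; last by rewrite !incidenceP.
rewrite (conv_upto _ _ _ (leqnn _)) (bigD1_seq x) ?vertices_upto_uniq//=.
  rewrite eqxx mul1r big1 ?addr0// => z.
  by rewrite eq_sym => /negbTE->; rewrite mul0r.
by rewrite mem_vertices_upto le_vlevel.
Qed.

Lemma convf1 : right_id delta conv.
Proof.
move=> f; apply: incidence_ext => x y.
rewrite (conv_upto _ _ _ (leqnn _)) (bigD1_seq y) ?vertices_upto_uniq//=.
  by rewrite eqxx mulr1 big1 ?addr0// => z /negbTE->; rewrite mulr0.
by rewrite mem_vertices_upto.
Qed.

Lemma convDl : left_distributive conv +%R.
Proof.
move=> f g h; apply: incidence_ext => x y.
rewrite inc_addE !(conv_upto _ _ _ (leqnn _)) -big_split.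
by apply: eq_bigr => z _; rewrite inc_addE mulrDl.
Qed.

Lemma convDr : right_distributive conv +%R.
Proof.
move=> f g h; apply: incidence_ext => x y.
rewrite inc_addE !(conv_upto _ _ _ (leqnn _)) -big_split.
by apply: eq_bigr => z _; rewrite inc_addE mulrDr.
Qed.

HB.instance Definition _ :=
  GRing.Zmodule_isPzRing.Build (incidence F R) convA conv1f convf1 convDl convDr.

Definition eta : incidence F R := zeta - delta.

Lemma etaE x y : eta x y = (x < y)%O%:R.
Proof.
rewrite [LHS](_ : _ = (x <= y)%O%:R - (x == y)%:R)// lt_neqAle.
by have [->|_] := eqVneq x y; rewrite ?lexx ?subrr ?subr0.
Qed.

End IncidenceOps.

Arguments delta F R : clear implicits.
Arguments zeta F R : clear implicits.
Arguments eta F R : clear implicits.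

(* (z_1, ..., z_m) with x < z_1 < ... < z_m < y; for m = 0 the only candidate is
   the empty tuple, and it is a member if and only if x < y. *)
Definition vertex_chains (F : nat -> nat) (m : nat) (x y : cobweb F) :
    set (m.-tuple (cobweb F)) :=
  [set z | path <%O x (rcons z y)].

(* (i_1, ..., i_m) with t < i_1 < ... < i_m < v, with the same convention. *)
Definition level_chains (m t v : nat) : set (m.-tuple nat) :=
  [set i | path ltn t (rcons i v)].

Arguments vertex_chains {F} m x y _.
Arguments level_chains m t v _ : clear implicits.

Lemma finite_bounded_tuples (T : choiceType) (m : nat) (s : seq T) :
  finite_set [set z : m.-tuple T | {subset z <= s}].
Proof.
pose f (w : m.-tuple (seq_sub s)) := map_tuple val w.
apply: (@sub_finite_set _ _ (f @` setT)); last first.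
  exact/finite_image/finite_finset.
move=> z /= zs.
have zP i : tnth z i \in s by apply: zs; exact: mem_tnth.
exists [tuple SeqSub (zP i) | i < m] => //.
by apply: eq_from_tnth => i; rewrite tnth_map tnth_mktuple.
Qed.

Lemma path_rcons_all (T : Type) (r : rel T) (x y : T) (s : seq T) :
  transitive r -> path r x (rcons s y) -> all (r^~ y) s.
Proof.
by move=> rT; rewrite path_pairwise//= pairwise_rcons => /andP[_ /andP[]].
Qed.

Lemma finite_vertex_chains (F : nat -> nat) (m : nat) (x y : cobweb F) :
  finite_set (vertex_chains m x y).
Proof.
apply: sub_finite_set (finite_bounded_tuples m (vertices_upto F (vlevel y))).
move=> z /(path_rcons_all lt_trans)/allP zy w /zy.
by rewrite mem_vertices_upto => /ltW /le_vlevel.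
Qed.

Lemma finite_level_chains (m t v : nat) : finite_set (level_chains m t v).
Proof.
apply: sub_finite_set (finite_bounded_tuples m (iota 0 v)).
by move=> i /(path_rcons_all ltn_trans)/allP iv j /iv; rewrite mem_iota.
Qed.

(* Main.v *)
Require Import Defs.
From mathcomp Require Import all_boot all_order all_algebra.
From mathcomp Require Import boolp classical_sets functions cardinality fsbigop.

(** Sums over chains [x < z_1 < ... < z_m < y] satisfy the recursion obtained
by fixing [z_1].  For chains of vertices it coincides with the recursion of the
powers of [eta], since [eta] is the indicator of [<].  As the strict order of
the cobweb poset only depends on levels, grouping the choices of [z_1] by level
[i > 0] produces the factor [F i], so that chains of vertices counted with
weight 1 and chains of levels counted with weight [F] obey the same
recursion. *)

Set Implicit Arguments.
Unset Strict Implicit.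
Unset Printing Implicit Defensive.

Import Order.TTheory GRing.Theory.

Local Open Scope ring_scope.
Local Open Scope classical_set_scope.

Section ChainEnumeration.
Variables (T : eqType) (r : rel T) (s : seq T).

(** An explicit list turns the sum over a set of chains into a sum over a sequence. In the base case
    the boolean [r x y] is read as 0 or 1 copies of the empty tuple. *)
Fixpoint chain_enum (m : nat) (x y : T) : seq (m.-tuple T) :=
  match m with
  | 0 => nseq (r x y) [tuple]
  | m'.+1 => [seq cons_tuple a z | a <- [seq a <- s | r x a],
                                      z <- chain_enum m' a y]
  end.

Lemma chain_enum_uniq m x y : uniq s -> uniq (chain_enum m x y).
Proof.
move=> us; elim: m x => [|m IHm] x /=; first by case: (r x y).
apply: allpairs_uniq_dep => [|a _|]; [exact: filter_uniq|exact: IHm|].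
move=> [a z] [b w] _ _ /= /(congr1 val)[<- zw].
by congr existT; exact: val_inj.
Qed.

Lemma mem_chain_enum m x y (z : m.-tuple T) :
  transitive r -> (forall a, r a y -> a \in s) ->
  (z \in chain_enum m x y) = path r x (rcons z y).
Proof.
move=> rT sP; elim: m x z => [|m IHm] x z.
  by rewrite tuple0 /= andbT; case: (r x y).
case/tupleP: z => a z /=; apply/allpairsPdep/andP => [[b [w [+ + zw]]]|[xa az]].
  move: (congr1 val zw) => /= [-> /val_inj ->]; rewrite mem_filter IHm.
  by move=> /andP[].
(* By transitivity the first entry [a] is itself related to [y], hence lies in [s]. *)
exists a, z; rewrite mem_filter IHm xa az; split=> //; apply: sP.
by move: az; rewrite path_sortedE// all_rcons => /andP[/andP[]].
Qed.

End ChainEnumeration.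

Section WeightedChains.
Variables (R : pzRingType) (T : choiceType) (r : rel T) (w : T -> R).

Definition chain_sum (m : nat) (x y : T) : R :=
  \sum_(z \in [set z : m.-tuple T | path r x (rcons z y)]) \prod_(a <- z) w a.

Variable s : seq T.
Hypotheses (rT : transitive r) (us : uniq s).

Lemma chain_sumE m x y : (forall a, r a y -> a \in s) ->
  chain_sum m x y = \sum_(z <- chain_enum r s m x y) \prod_(a <- z) w a.
Proof.
move=> sP; rewrite fsbig_seq ?chain_enum_uniq//; apply: eq_fsbigl.
by apply/seteqP; split=> z /=; rewrite mem_chain_enum.
Qed.

(** Splits off the first entry of the chain. Keeping the condition on it as a factor 0 or 1 gives
    the shape of a convolution with [eta]. *)
Lemma chain_sumS m x y : (forall a, r a y -> a \in s) ->
  chain_sum m.+1 x y = \sum_(a <- s) (r x a)%:R * (w a * chain_sum m a y).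
Proof.
move=> sP; rewrite chain_sumE//= big_allpairs_dep/= big_filter big_mkcond/=.
apply: eq_bigr => a _; case: (r x a); rewrite ?mul0r// mul1r chain_sumE//.
by rewrite mulr_sumr; apply: eq_bigr => z _; rewrite big_cons.
Qed.

End WeightedChains.

Lemma chain_sum0 (R : pzRingType) (T : choiceType) (r : rel T) (w : T -> R) x y :
  chain_sum r w 0 x y = (r x y)%:R.
Proof.
rewrite /chain_sum; case: (boolP (r x y)) => [|/negbTE] xy; last first.
  by rewrite fsbig1// => z /=; rewrite tuple0 /= xy.
rewrite (_ : mkset _ = [set [tuple]]) ?fsbig_set1 ?big_nil//.
by apply/seteqP; split=> z /=; rewrite tuple0 /= xy.
Qed.

Section CobwebChains.
Variables (R : pzRingType) (F : nat -> nat).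
Implicit Types x y : cobweb F.

Lemma eta_exp_chain_sum m x y :
  (eta F R ^+ m.+1) x y = chain_sum <%O (fun=> 1 : R) m x y.
Proof.
elim: m x => [|m IHm] x; first by rewrite chain_sum0 expr1 etaE.
(* The left factor [eta] chooses the first entry of the chain. *)
rewrite exprS (conv_upto _ _ _ (leqnn _)).
rewrite (chain_sumS _ (@lt_trans _ _) (vertices_upto_uniq F (vlevel y))).
  by apply: eq_bigr => a _; rewrite etaE IHm mul1r.
by move=> a /ltW /le_vlevel; rewrite mem_vertices_upto.
Qed.

Lemma sum_vertices_upto n (g : nat -> R) :
  \sum_(a <- vertices_upto F n) g (vlevel a) =
  \sum_(i <- iota 0 n.+1) (level_size F i)%:R * g i.
Proof.
(* Passing to the underlying pairs makes the vertices a permutation of the list [l], which is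
   already grouped by level. *)
rewrite -(big_map val xpredT (fun p => g p.2)).
set l := [seq (j, i) | i <- iota 0 n.+1, j <- iota 1 (level_size F i)].
have ul : uniq l.
  apply: allpairs_uniq_dep => [|i _|]; rewrite ?iota_uniq//.
  by move=> [i j] [i' j'] _ _ /= [-> ->].
rewrite (perm_big l) /=; last first.
  apply: uniq_perm => //.
    by rewrite map_inj_uniq ?vertices_upto_uniq//; exact: val_inj.
  move=> p; apply/mapP/idP => [[a + ->]|pl].
    by rewrite mem_undup mem_pmap_sub.
  have pV : is_vertex F p.
    by case/allpairsPdep: pl => i [j [_ + ->]]; rewrite mem_iota add1n ltnS.
  by exists (Vertex pV); rewrite // mem_undup mem_pmap_sub.
rewrite big_allpairs_dep/=; apply: eq_bigr => i _.
by rewrite big_const_seq count_predT size_iota iter_addr_0 mulr_natl.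
Qed.

Lemma chain_sum_vlevel m x y :
  chain_sum <%O (fun=> 1 : R) m x y =
  chain_sum ltn (fun i => (F i)%:R : R) m (vlevel x) (vlevel y).
Proof.
elim: m x => [|m IHm] x; first by rewrite !chain_sum0 cobweb_ltE.
rewrite (chain_sumS _ (@lt_trans _ _) (vertices_upto_uniq F (vlevel y))).
  rewrite (chain_sumS _ ltn_trans (iota_uniq 0 (vlevel y).+1)).
    (* By induction the summand depends on the vertex only through its level. *)
    pose g i : R := (vlevel x < i)%:R *
      chain_sum ltn (fun i => (F i)%:R : R) m i (vlevel y).
    rewrite (eq_bigr (fun a => g (vlevel a))) ?sum_vertices_upto; last first.
      by move=> a _; rewrite mul1r IHm cobweb_ltE.
    (* The root level has size 1 whatever [F 0] is, but no level lies below 0, so both terms vanish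
       there; at positive levels [level_size F] is [F]. *)
    apply: eq_bigr => -[|i] _; first by rewrite /g !mul0r mulr0.
    by rewrite /g; case: (_ < _)%N; rewrite ?mul0r ?mulr0 ?mul1r.
  by move=> i /ltnW; rewrite mem_iota.
by move=> a /ltW /le_vlevel; rewrite mem_vertices_upto.
Qed.

End CobwebChains.

Theorem mainTheorem4 (R : pzRingType) (F : nat -> nat)
  (hF : forall n : nat, (0 < n)%N -> (0 < F n)%N)
  (hF0 : F 0%N = 1%N \/ F 0%N = 0%N)
  (k : nat) (hk : (0 < k)%N) (x y : cobweb F) :
  (eta F R ^+ k) x y = \sum_(z \in vertex_chains k.-1 x y) (1 : R) /\
  \sum_(z \in vertex_chains k.-1 x y) (1 : R) =
    \sum_(i \in level_chains k.-1 (vlevel x) (vlevel y))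
      \prod_(j <- i) ((F j)%:R : R).
Proof.
case: k hk => // m _ /=.
(* Each chain has weight a product of ones. *)
have -> : \sum_(z \in vertex_chains m x y) (1 : R) =
    chain_sum <%O (fun=> 1 : R) m x y.
  by apply: eq_fsbigr => z _; rewrite big1_eq.
by split; [exact: eta_exp_chain_sum|exact: chain_sum_vlevel].
Qed.
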